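(* Let $\mathscr T=(A,T,G)$ be a regularity structure with a product $\star$, and let $(\Pi,\Gamma)$ be a model for $\mathscr T$ on $\mathbb R^d$ with scaling $\mathfrak s$. Let $(V,W)$ be a pair of sectors with regularities $\alpha_1$ and $\alpha_2$ respectively, let $f_1\in\mathcal D^{\gamma_1}(V)$ and $f_2\in\mathcal D^{\gamma_2}(W)$, and let $\gamma=(\gamma_1+\alpha_2)\wedge(\gamma_2+\alpha_1)$. Then, provided that $(V,W)$ is $\gamma$-regular, one has $f_1\star f_2\in\mathcal D^\gamma(T)$ and, for every compact set $\mathfrak K$, the bound $$|||f_1\star f_2|||_{\gamma;\mathfrak K}\lesssim|||f_1|||_{\gamma_1;\mathfrak K}\,|||f_2|||_{\gamma_2;\mathfrak K}\,(1+\|\Gamma\|_{\gamma_1+\gamma_2;\mathfrak K})^2$$ holds for some proportionality constant only depending on the underlying structure $\mathscr T$.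
   Context: Regularity structure: a triple $\mathscr T=(A,T,G)$ where $A\subset\mathbb R$ contains $0$, is bounded from below and locally finite; $T=\bigoplus_{\alpha\in A}T_\alpha$ with each $T_\alpha$ a Banach space and $T_0\simeq\mathbb R$ with unit vector $\mathbf 1$; $G$ is a group of linear operators on $T$ with $\Gamma\mathbf 1=\mathbf 1$ and $\Gamma a-a\in\bigoplus_{\beta<\alpha}T_\beta$ for all $\Gamma\in G$, $a\in T_\alpha$. Write $\mathcal Q_\alpha$ for the projection onto $T_\alpha$, $\|a\|_\alpha=\|\mathcal Q_\alpha a\|$, $T_\gamma^-=\bigoplus_{\beta<\gamma}T_\beta$. Scaling: $\mathfrak s$ is a vector of strictly positive relatively prime integers, $|\mathfrak s|=\sum_i\mathfrak s_i$, $\|x-y\|_{\mathfrak s}=\sum_i|x_i-y_i|^{1/\mathfrak s_i}$, $B_{\mathfrak s}(0,1)$ is the corresponding unit ball, and $(\mathcal S^\delta_{\mathfrak s,x}\phi)(y)=\delta^{-|\mathfrak s|}\phi(\delta^{-\mathfrak s_1}(y_1-x_1),\dots,\delta^{-\mathfrak s_d}(y_d-x_d))$. Model $(\Pi,\Gamma)$: a map $\Gamma:\mathbb R^d\times\mathbb R^d\to G$ with $\Gamma_{xx}=1$, $\Gamma_{xy}\Gamma_{yz}=\Gamma_{xz}$, and continuous linear maps $\Pi_x:T\to\mathcal S'(\mathbb R^d)$ with $\Pi_y=\Pi_x\Gamma_{xy}$, such that for every $\gamma>0$ and compact $\mathfrak K$ there is $C$ with $|(\Pi_xa)(\mathcal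 S^\delta_{\mathfrak s,x}\phi)|\le C\|a\|\delta^\ell$ and $\|\Gamma_{xy}a\|_m\le C\|a\|\,\|x-y\|_{\mathfrak s}^{\ell-m}$ uniformly over $x,y\in\mathfrak K$, $\delta\in(0,1]$, smooth $\phi$ supported in $B_{\mathfrak s}(0,1)$ with $\|\phi\|_{\mathcal C^{r}}\le1$ ($r$ the smallest integer with $\ell>-r$ for all $\ell\in A$), $\ell\in A$ with $\ell<\gamma$, $m<\ell$, $a\in T_\ell$. $\|\Gamma\|_{\gamma;\mathfrak K}$ is the smallest constant in the second bound. Modelled distributions: $\mathcal D^\gamma$ is the space of $f:\mathbb R^d\to T_\gamma^-$ such that for every compact $\mathfrak K$ $$|||f|||_{\gamma;\mathfrak K}=\sup_{x\in\mathfrak K}\sup_{\beta<\gamma}\|f(x)\|_\beta+\sup_{x,y\in\mathfrak K,\ \|x-y\|_{\mathfrak s}\le1}\sup_{\beta<\gamma}\frac{\|f(x)-\Gamma_{xy}f(y)\|_\beta}{\|x-y\|_{\mathfrak s}^{\gamma-\beta}}<\infty$$ ($\beta\in A$); $\mathcal D^\gamma(V)$ denotes those $f\in\mathcal D^\gamma$ with values in $V$. A statement ''$f\in\mathcal D^\gamma$'' for $f$ not $T_\gamma^-$-valued refers to the projection of $f$ onto $T_\gamma^-$; in particular $f_1\star f_2$ stands for $x\mapsto\sum_{m+n<\gamma}\mathcal Q_mf_1(x)\star\mathcal Q_nf_2(x)$. Sector of regularity $\alpha\le0$: a graded subspace $V=\bigoplus_\beta V_\beta$, $V_\beta\subset T_\beta$,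 with $V_\beta=\{0\}$ for $\beta<\alpha$, $\Gamma V\subset V$ for all $\Gamma\in G$, and each $V_\beta$ complemented in $T_\beta$. Product: a bilinear map $\star:T\times T\to T$, continuous from $T_\alpha\times T_\beta$ to $T_{\alpha+\beta}$ for all $\alpha,\beta\in A$ (so $a\star b\in T_{\alpha+\beta}$ for $a\in T_\alpha$, $b\in T_\beta$, with $T_{\alpha+\beta}=\{0\}$ if $\alpha+\beta\notin A$), with $\mathbf 1\star a=a\star\mathbf 1=a$. The pair $(V,W)$ is $\gamma$-regular if $\Gamma(a\star b)=(\Gamma a)\star(\Gamma b)$ for every $\Gamma\in G$ and all $a\in V_\alpha$, $b\in W_\beta$ with $\alpha+\beta<\gamma$.
   Formalization: The norm bound is proved only for γ1, γ2 ≥ 0 (it fails for negative exponents), and its constant may also depend on the product, γ1 and γ2 (independence of γ1, γ2 is false in general); f1⋆f2 ∈ D^γ is proved for all real γ1, γ2. *)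

(* Defs.v *)
From HB Require Import structures.
From mathcomp Require Import all_boot all_order all_algebra.
From mathcomp Require Import all_classical all_reals all_analysis.
Set Implicit Arguments.
Unset Strict Implicit.
Unset Printing Implicit Defensive.
Import Order.TTheory GRing.Theory Num.Theory.
Import numFieldNormedType.Exports.
Local Open Scope classical_set_scope.
Local Open Scope ring_scope.

(** The algebraic direct sum of the family [T_]: dependent functions of finite
    support. The index ranges over all of R; a regularity structure requires
    [T_ alpha] to be trivial when alpha is not in its index set. *)
Record gsum (R : realType) (T_ : R -> completeNormedModType R) := Gsum {
  gval :> forall alpha : R, T_ alpha ;
  gval_fin : finite_set [set alpha | gval alpha != 0] }.

Lemma gsumP (R : realType) (T_ : R -> completeNormedModType R) (a b : gsum T_) :
  (forall alpha, a alpha = b alpha) -> a = b.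
Proof.
case: a b => [a af] [b bf] /= ab.
have e : a = b by exact: functional_extensionality_dep.
by subst b; congr Gsum; exact: Prop_irrelevance.
Qed.

Lemma gsum0_subproof (R : realType) (T_ : R -> completeNormedModType R) :
  finite_set [set alpha | (0 : T_ alpha) != 0].
Proof. by apply: (sub_finite_set _ (finite_set0 R)) => x /=; rewrite eqxx. Qed.

Definition gsum0 (R : realType) (T_ : R -> completeNormedModType R) : gsum T_ :=
  Gsum (gsum0_subproof T_).

Lemma gsumD_subproof (R : realType) (T_ : R -> completeNormedModType R)
  (a b : gsum T_) : finite_set [set alpha | a alpha + b alpha != 0].
Proof.
apply: (@sub_finite_set _ _
  ([set x | a x != 0] `|` [set x | b x != 0])).
  move=> x /=; have [->|] := eqVneq (a x) 0; last by left.
  by rewrite add0r => ?; right.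
by rewrite finite_setU; split; apply: gval_fin.
Qed.

Definition gsumD (R : realType) (T_ : R -> completeNormedModType R)
  (a b : gsum T_) : gsum T_ := Gsum (gsumD_subproof a b).

Lemma gsumN_subproof (R : realType) (T_ : R -> completeNormedModType R)
  (a : gsum T_) : finite_set [set alpha | - a alpha != 0].
Proof.
by apply: sub_finite_set (gval_fin a) => x /=; rewrite oppr_eq0.
Qed.

Definition gsumN (R : realType) (T_ : R -> completeNormedModType R)
  (a : gsum T_) : gsum T_ := Gsum (gsumN_subproof a).

Lemma gsumZ_subproof (R : realType) (T_ : R -> completeNormedModType R)
  (c : R) (a : gsum T_) : finite_set [set alpha | c *: a alpha != 0].
Proof.
apply: sub_finite_set (gval_fin a) => x /=.
by apply: contra_neq => ->; rewrite scaler0.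
Qed.

Definition gsumZ (R : realType) (T_ : R -> completeNormedModType R)
  (c : R) (a : gsum T_) : gsum T_ := Gsum (gsumZ_subproof c a).

Lemma gsumA (R : realType) (T_ : R -> completeNormedModType R) :
  associative (@gsumD R T_).
Proof. by move=> a b c; apply: gsumP => x /=; rewrite addrA. Qed.

Lemma gsumC (R : realType) (T_ : R -> completeNormedModType R) :
  commutative (@gsumD R T_).
Proof. by move=> a b; apply: gsumP => x /=; rewrite addrC. Qed.

Lemma gsum0D (R : realType) (T_ : R -> completeNormedModType R) :
  left_id (gsum0 T_) (@gsumD R T_).
Proof. by move=> a; apply: gsumP => x /=; rewrite add0r. Qed.

Lemma gsumND (R : realType) (T_ : R -> completeNormedModType R) :
  left_inverse (gsum0 T_) (@gsumN R T_) (@gsumD R T_).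
Proof. by move=> a; apply: gsumP => x /=; rewrite addNr. Qed.

HB.instance Definition _ (R : realType) (T_ : R -> completeNormedModType R) :=
  gen_eqMixin (gsum T_).
HB.instance Definition _ (R : realType) (T_ : R -> completeNormedModType R) :=
  gen_choiceMixin (gsum T_).
HB.instance Definition _ (R : realType) (T_ : R -> completeNormedModType R) :=
  GRing.isZmodule.Build (gsum T_)
    (@gsumA R T_) (@gsumC R T_) (@gsum0D R T_) (@gsumND R T_).

Lemma gsumZA (R : realType) (T_ : R -> completeNormedModType R) (c e : R)
  (a : gsum T_) : gsumZ c (gsumZ e a) = gsumZ (c * e) a.
Proof. by apply: gsumP => x /=; rewrite scalerA. Qed.

Lemma gsum1Z (R : realType) (T_ : R -> completeNormedModType R) :
  left_id 1 (@gsumZ R T_).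
Proof. by move=> a; apply: gsumP => x /=; rewrite scale1r. Qed.

Lemma gsumZDr (R : realType) (T_ : R -> completeNormedModType R) :
  right_distributive (@gsumZ R T_) +%R.
Proof. by move=> c a b; apply: gsumP => x /=; rewrite scalerDr. Qed.

Lemma gsumZDl (R : realType) (T_ : R -> completeNormedModType R)
  (a : gsum T_) : {morph (@gsumZ R T_)^~ a : c e / c + e}.
Proof. by move=> c e; apply: gsumP => x /=; rewrite scalerDl. Qed.

HB.instance Definition _ (R : realType) (T_ : R -> completeNormedModType R) :=
  GRing.Zmodule_isLmodule.Build R (gsum T_)
    (@gsumZA R T_) (@gsum1Z R T_) (@gsumZDr R T_) (@gsumZDl R T_).

Definition ginj_fun (R : realType) (T_ : R -> completeNormedModType R)
  (alpha : R) (u : T_ alpha) (beta : R) : T_ beta :=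
  if pselect (alpha = beta) is left e then ecast b (T_ b) e u else 0.

Lemma ginj_subproof (R : realType) (T_ : R -> completeNormedModType R)
  (alpha : R) (u : T_ alpha) :
  finite_set [set beta | ginj_fun u beta != 0].
Proof.
apply: (sub_finite_set _ (finite_set1 alpha)) => b /=.
by rewrite /ginj_fun; case: pselect => [e _|_]; [exact/esym|rewrite eqxx].
Qed.

(** The inclusion of T_alpha into the direct sum. *)
Definition ginj (R : realType) (T_ : R -> completeNormedModType R)
  (alpha : R) (u : T_ alpha) : gsum T_ := Gsum (ginj_subproof u).

Record regularity_structure (R : realType) := RegularityStructure {
  rs_idx : set R ;
  rs_comp : R -> completeNormedModType R ;
  rs_grp : set {linear gsum rs_comp -> gsum rs_comp} ;
  rs_one : rs_comp 0 ;
  rs_idx0 : rs_idx 0 ;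
  rs_idx_lbound : has_lbound rs_idx ;
  rs_idx_locally_finite : forall x y : R, finite_set (rs_idx `&` `[x, y]) ;
  rs_comp_trivial : forall alpha, ~ rs_idx alpha ->
    forall u : rs_comp alpha, u = 0 ;
  rs_one_norm : `|rs_one| = 1 ;
  rs_one_span : forall u : rs_comp 0, exists c : R, u = c *: rs_one ;
  rs_grp_id : exists2 g, rs_grp g & g =1 id ;
  rs_grp_comp : forall g h, rs_grp g -> rs_grp h ->
    exists2 k, rs_grp k & k =1 g \o h ;
  rs_grp_inv : forall g, rs_grp g ->
    exists2 h, rs_grp h & cancel g h /\ cancel h g ;
  rs_grp_one : forall g, rs_grp g -> g (ginj rs_one) = ginj rs_one ;
  rs_grp_lower : forall g, rs_grp g ->
    forall alpha (u : rs_comp alpha) beta, alpha <= beta ->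
      (g (ginj u) - ginj u) beta = 0 }.

Notation tspace S := (gsum (@rs_comp _ S)).

(** T_gamma^- *)
Definition tbelow (R : realType) (S : regularity_structure R) (gamma : R) :
    set (tspace S) :=
  [set a | forall beta, gamma <= beta -> a beta = 0].

(** Q_alpha, as a map from T to itself *)
Definition tproj (R : realType) (S : regularity_structure R) (alpha : R)
  (a : tspace S) : tspace S := ginj (a alpha).

Record scaling (d : nat) := Scaling {
  sc :> 'I_d -> nat ;
  sc_gt0 : forall i, (0 < sc i)%N ;
  sc_coprime : (\big[gcdn/0]_(i < d) sc i = 1)%N }.

Definition sdim (d : nat) (s : scaling d) : nat := (\sum_(i < d) s i)%N.

Definition snorm (R : realType) (d : nat) (s : scaling d) (x : 'rV[R]_d) : R :=
  \sum_(i < d) `|x 0 i| `^ (s i)%:R^-1.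

Definition rescale (R : realType) (d : nat) (s : scaling d) (delta : R)
    (x : 'rV[R]_d) (phi : 'rV[R]_d -> R) : 'rV[R]_d -> R :=
  fun y => delta ^- sdim s * phi (\row_i (delta ^- s i * (y 0 i - x 0 i))).

(** Iterated partial derivative along the coordinates listed in [k]. *)
Definition partials (R : realType) (d : nat) (k : seq 'I_d)
    (phi : 'rV[R]_d -> R) : 'rV[R]_d -> R :=
  foldr (fun i psi x => 'D_(delta_mx 0 i) psi x) phi k.

Definition smooth (R : realType) (d : nat) (phi : 'rV[R]_d -> R) : Prop :=
  forall (k : seq 'I_d) x, differentiable (partials k phi) x.

Definition schwartz (R : realType) (d : nat) : set ('rV[R]_d -> R) :=
  [set phi | smooth phi /\ forall (n : nat) (k : seq 'I_d), exists M : R,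
     forall x, (1 + `|x|) ^+ n * `|partials k phi x| <= M].

(** Tempered distributions: a functional is given on all functions, but only its
    values on Schwartz functions are meaningful; it is linear there and
    continuous for the Schwartz seminorms. *)
Definition tempered (R : realType) (d : nat) : set (('rV[R]_d -> R) -> R) :=
  [set u |
    (forall (c : R) phi psi, schwartz phi -> schwartz psi ->
       u (fun x => c * phi x + psi x) = c * u phi + u psi) /\
    exists (N : nat) (C : R), forall phi (M : R), schwartz phi ->
      (forall k : seq 'I_d, (size k <= N)%N -> forall x,
         (1 + `|x|) ^+ N * `|partials k phi x| <= M) ->
      `|u phi| <= C * M].

(** Smooth functions supported in the unit ball with C^r norm at most 1. *)
Definition test_function (R : realType) (d : nat) (s : scaling d) (r : nat) :
    set ('rV[R]_d -> R) :=
  [set phi | [/\ smooth phi,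
     closure [set y | phi y != 0] `<=` [set y | snorm s y < 1] &
     forall k : seq 'I_d, (size k <= r)%N -> forall x,
       `|partials k phi x| <= 1]].

(** The smallest integer r with l > - r for all l in A; since 0 is in A such an
    integer is positive, so it may be sought among the natural numbers. *)
Definition test_order (R : realType) (S : regularity_structure R) (r : nat) :
    Prop :=
  (forall l, rs_idx S l -> - r%:R < l) /\
  forall n : nat, (forall l, rs_idx S l -> - n%:R < l) -> (r <= n)%N.

Definition Gamma_bound (R : realType) (S : regularity_structure R) (d : nat)
    (s : scaling d)
    (Gamma : 'rV[R]_d -> 'rV[R]_d -> {linear tspace S -> tspace S})
    (gamma : R) (K : set 'rV[R]_d) (C : R) : Prop :=
  forall x y, K x -> K y ->
  forall l, rs_idx S l -> l < gamma -> forall m, rs_idx S m -> m < l ->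
  forall u : rs_comp S l,
    `|Gamma x y (ginj u) m| <= C * `|u| * snorm s (x - y) `^ (l - m).

Definition Pi_bound (R : realType) (S : regularity_structure R) (d : nat)
    (s : scaling d) (Pi : 'rV[R]_d -> tspace S -> ('rV[R]_d -> R) -> R)
    (gamma : R) (K : set 'rV[R]_d) (C : R) : Prop :=
  forall x, K x -> forall delta, 0 < delta <= 1 ->
  forall r, test_order S r -> forall phi, test_function s r phi ->
  forall l, rs_idx S l -> l < gamma -> forall u : rs_comp S l,
    `|Pi x (ginj u) (rescale s delta x phi)| <= C * `|u| * delta `^ l.

(** In [model_Pi_continuous], the direct sum carries the direct sum topology, so
    that continuity is continuity on each T_alpha, and the space of tempered
    distributions carries the weak-* topology; as T_alpha is a Banach space, the
    strong topology would give the same notion. *)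
Record model (R : realType) (S : regularity_structure R) (d : nat)
    (s : scaling d) := Model {
  model_Gamma : 'rV[R]_d -> 'rV[R]_d -> {linear tspace S -> tspace S} ;
  model_Pi : 'rV[R]_d -> tspace S -> ('rV[R]_d -> R) -> R ;
  model_Gamma_grp : forall x y, rs_grp (model_Gamma x y) ;
  model_Gamma_id : forall x a, model_Gamma x x a = a ;
  model_Gamma_comp : forall x y z a,
    model_Gamma x y (model_Gamma y z a) = model_Gamma x z a ;
  model_Pi_tempered : forall x a, tempered (model_Pi x a) ;
  model_Pi_linear : forall x (c : R) a b phi, schwartz phi ->
    model_Pi x (c *: a + b) phi = c * model_Pi x a phi + model_Pi x b phi ;
  model_Pi_continuous : forall x alpha phi, schwartz phi ->
    continuous (fun u : rs_comp S alpha => model_Pi x (ginj u) phi) ;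
  model_Pi_Gamma : forall x y a phi, schwartz phi ->
    model_Pi y a phi = model_Pi x (model_Gamma x y a) phi ;
  model_bounds : forall gamma, 0 < gamma ->
    forall K : set 'rV[R]_d, compact K -> exists C : R,
      Pi_bound s model_Pi gamma K C /\ Gamma_bound s model_Gamma gamma K C }.

(** ||Gamma||_{gamma; K} *)
Definition Gamma_norm (R : realType) (S : regularity_structure R) (d : nat)
    (s : scaling d) (M : model S s) (gamma : R) (K : set 'rV[R]_d) : R :=
  inf [set C | 0 <= C /\ Gamma_bound s (model_Gamma M) gamma K C].

(** Supremum in [0, +oo], so that the supremum of the empty set is 0. *)
Definition nonneg_sup (R : realType) (E : set R) : \bar R :=
  ereal_sup ([set 0%E] `|` EFin @` E).

Definition moddist_size (R : realType) (S : regularity_structure R) (d : nat)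
    (gamma : R) (K : set 'rV[R]_d) (f : 'rV[R]_d -> tspace S) : \bar R :=
  nonneg_sup [set r | exists x beta,
    [/\ K x, rs_idx S beta, beta < gamma & r = `|f x beta| ] ].

(** The pairs x = y contribute 0, as 0 `^ (gamma - beta) = 0 and division by 0
    gives 0. *)
Definition moddist_osc (R : realType) (S : regularity_structure R) (d : nat)
    (s : scaling d) (M : model S s) (gamma : R) (K : set 'rV[R]_d)
    (f : 'rV[R]_d -> tspace S) : \bar R :=
  nonneg_sup [set r | exists x y beta,
    [/\ K x /\ K y, snorm s (x - y) <= 1, rs_idx S beta, beta < gamma &
       r = `|(f x - model_Gamma M x y (f y)) beta|
             / snorm s (x - y) `^ (gamma - beta)] ].

(** |||f|||_{gamma; K} *)
Definition moddist_norm (R : realType) (S : regularity_structure R) (d : nat)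
    (s : scaling d) (M : model S s) (gamma : R) (K : set 'rV[R]_d)
    (f : 'rV[R]_d -> tspace S) : \bar R :=
  (moddist_size gamma K f + moddist_osc M gamma K f)%E.

(** The space D^gamma *)
Definition moddist (R : realType) (S : regularity_structure R) (d : nat)
    (s : scaling d) (M : model S s) (gamma : R) : set ('rV[R]_d -> tspace S) :=
  [set f | (forall x, tbelow gamma (f x)) /\
     forall K : set 'rV[R]_d, compact K -> (moddist_norm M gamma K f < +oo)%E].

Definition linear_subspace (R : realType) (E : lmodType R) (V : set E) : Prop :=
  V 0 /\ forall (c : R) u v, V u -> V v -> V (c *: u + v).

Definition complemented (R : realType) (E : normedModType R) (V : set E) :
    Prop :=
  closed V /\ exists W : set E,
    [/\ linear_subspace W, closed W, V `&` W = [set 0] &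
    forall u, exists v w, [/\ V v, W w & u = v + w]].

Definition in_graded (R : realType) (S : regularity_structure R)
    (V : forall beta, set (rs_comp S beta)) : set (tspace S) :=
  [set a | forall beta, V beta (a beta)].

Record sector (R : realType) (S : regularity_structure R) (alpha : R) :=
  Sector {
  sector_comp :> forall beta, set (rs_comp S beta) ;
  sector_le0 : alpha <= 0 ;
  sector_subspace : forall beta, linear_subspace (@sector_comp beta) ;
  sector_low : forall beta, beta < alpha -> @sector_comp beta = [set 0] ;
  sector_grp : forall g, rs_grp g -> forall a : tspace S,
    in_graded (@sector_comp) a -> in_graded (@sector_comp) (g a) ;
  sector_compl : forall beta, complemented (@sector_comp beta) }.

Arguments sector_comp {R S alpha} s beta _.

(** D^gamma(V) *)
Definition moddist_in (R : realType) (S : regularity_structure R) (d : nat)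
    (s : scaling d) (M : model S s) (gamma alpha : R) (V : sector S alpha) :
    set ('rV[R]_d -> tspace S) :=
  [set f | moddist M gamma f /\ forall x, in_graded V (f x)].

Record product (R : realType) (S : regularity_structure R) := Product {
  star :> {bilinear tspace S -> tspace S -> tspace S} ;
  star_graded : forall alpha beta, rs_idx S alpha -> rs_idx S beta ->
    forall (u : rs_comp S alpha) (v : rs_comp S beta) gamma,
      gamma != alpha + beta ->
      star (ginj u) (ginj v) gamma = 0 ;
  star_continuous : forall alpha beta, rs_idx S alpha -> rs_idx S beta ->
    continuous (fun p : rs_comp S alpha * rs_comp S beta =>
      star (ginj p.1) (ginj p.2) (alpha + beta)) ;
  star_1l : forall a, star (ginj (rs_one S)) a = a ;
  star_1r : forall a, star a (ginj (rs_one S)) = a }.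

Definition regular_pair (R : realType) (S : regularity_structure R)
    (P : product S) (gamma alpha1 alpha2 : R)
    (V : sector S alpha1) (W : sector S alpha2) : Prop :=
  forall g, rs_grp g ->
  forall alpha beta (u : rs_comp S alpha) (v : rs_comp S beta),
    V alpha u -> W beta v -> alpha + beta < gamma ->
    g (P (ginj u) (ginj v)) = P (g (ginj u)) (g (ginj v)).

(** f1 * f2 projected onto T_gamma^-. For each x only finitely many terms of the
    sum are nonzero. *)
Definition moddist_mul (R : realType) (S : regularity_structure R)
    (P : product S) (d : nat) (gamma : R) (f1 f2 : 'rV[R]_d -> tspace S) :
    'rV[R]_d -> tspace S :=
  fun x => \sum_(p \in [set p : R * R |
                   [/\ rs_idx S p.1, rs_idx S p.2 & p.1 + p.2 < gamma]])
    P (tproj p.1 (f1 x)) (tproj p.2 (f2 x)).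

(* Main.v *)
(** Put [D_i = f_i x - Gamma_xy f_i y]. For [beta < gamma], multiplicativity of
    [Gamma_xy] on the levels [m + n < gamma] gives
      [(f1 * f2) x - Gamma_xy ((f1 * f2) y)
         = f1 x * D_2 + D_1 * Gamma_xy f2 y
           + \sum_(m + n >= gamma) Gamma_xy Q_m f1 y * Gamma_xy Q_n f2 y]
    in degree [beta]. In the first two terms one factor is an increment and the
    other is bounded and lives in degrees at least [alpha_i], which yields the
    exponents [gamma_2 + alpha_1 - beta] and [gamma_1 + alpha_2 - beta]; in the
    last sum the two bounds on Gamma give the exponent
    [m + n - beta >= gamma - beta]. Only finitely many levels below
    [max gamma_1 gamma_2] occur, whence a constant that depends on the
    structure, the product, [gamma_1] and [gamma_2] alone. *)
From HB Require Import structures.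
Require Import Defs.
From mathcomp Require Import all_boot all_order all_algebra.
From mathcomp Require Import all_classical all_reals all_analysis.
From mathcomp Require Import ring lra.
Import Order.TTheory GRing.Theory Num.Theory.
Import numFieldNormedType.Exports.
Local Open Scope classical_set_scope.
Local Open Scope ring_scope.

(** * Direct sums and their homogeneous components *)

Section DirectSum.
Context {R : realType} {T_ : R -> completeNormedModType R}.
Implicit Types a b : gsum T_.

Lemma gval_sum (I : Type) (r : seq I) (Q : pred I) (E : I -> gsum T_) k :
  (\sum_(i <- r | Q i) E i) k = \sum_(i <- r | Q i) E i k.
Proof. exact: (big_morph (fun a : gsum T_ => a k)). Qed.

Lemma gval_linear (c : R) a b k : (c *: a + b) k = c *: a k + b k.
Proof. by []. Qed.

Lemma gvalB a b k : (a - b) k = a k - b k.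
Proof. by []. Qed.

Lemma ginj_id k (u : T_ k) : ginj u k = u.
Proof.
rewrite /= /ginj_fun; case: pselect => [e|//].
by rewrite (Prop_irrelevance e erefl).
Qed.

Lemma ginj_neq k l (u : T_ k) : k != l -> ginj u l = 0.
Proof. by move=> /eqP kl; rewrite /= /ginj_fun; case: pselect. Qed.

Lemma ginjP (c : R) k (u v : T_ k) : ginj (c *: u + v) = c *: ginj u + ginj v.
Proof.
apply: gsumP => l; rewrite gval_linear.
have [<-|kl] := eqVneq k l; first by rewrite !ginj_id.
by rewrite !ginj_neq// scaler0 addr0.
Qed.

Lemma ginj0 k : ginj (0 : T_ k) = 0.
Proof.
apply: gsumP => l; have [<-|kl] := eqVneq k l; first by rewrite ginj_id.
by rewrite ginj_neq.
Qed.

(** [F] may exceed the support, so that one list serves all values of a modelled distribution at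
    once. *)
Lemma gsum_ginj (F : seq R) a : uniq F ->
  (forall k, k \notin F -> a k = 0) -> a = \sum_(k <- F) ginj (a k).
Proof.
move=> uF aF; apply: gsumP => k; rewrite gval_sum.
have [kF|kF] := boolP (k \in F); last first.
  rewrite aF// big_seq big1// => l lF; apply: ginj_neq.
  by apply: contraNneq kF => <-.
rewrite (bigD1_seq k)// ginj_id big1 => [|l lk]; last exact: ginj_neq.
exact/esym/addr0.
Qed.

End DirectSum.

(** * Norm bounds for the product on finitely many levels *)

Lemma ler_norm_sum_const (R : realType) (V : normedModType R) (F : seq R)
  (E : R -> V) B :
  (forall m, m \in F -> `|E m| <= B) -> `|\sum_(m <- F) E m| <= (size F)%:R * B.
Proof.
move=> EB; apply: (le_trans (ler_norm_sum _ _ _)).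
rewrite big_seq; apply: (le_trans (ler_sum _ EB)).
by rewrite -big_seq big_const_seq count_predT iter_addr_0 mulr_natl.
Qed.

Section Star.
Context {R : realType} {S : regularity_structure R} (P : product S).

(** The only degree that the product of two homogeneous elements can occupy. As a bilinear map
    between normed spaces it turns continuity into a norm bound. *)
Definition star_component alpha beta (u : rs_comp S alpha)
  (v : rs_comp S beta) : rs_comp S (alpha + beta) :=
  P (ginj u) (ginj v) (alpha + beta).

Lemma star_component_bilinear alpha beta :
  bilinear_for *:%R *:%R (@star_component alpha beta).
Proof.
split=> [v c u w|u c v w]; rewrite /star_component ginjP.
  by rewrite linearPl.
by rewrite linearPr.
Qed.

HB.instance Definition _ alpha beta := bilinear_isBilinear.Build R
  (rs_comp S alpha) (rs_comp S beta) (rs_comp S (alpha + beta)) _ _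
  (@star_component alpha beta) (star_component_bilinear alpha beta).

Definition star_bounded (F : seq R) (C : R) :=
  forall m n, m \in F -> n \in F ->
  forall (u : rs_comp S m) (v : rs_comp S n) k,
    `|P (ginj u) (ginj v) k| <= C * `|u| * `|v|.

Lemma star_bounded_pair m n : rs_idx S m -> rs_idx S n -> exists2 C, 0 <= C &
  forall (u : rs_comp S m) (v : rs_comp S n) k,
    `|P (ginj u) (ginj v) k| <= C * `|u| * `|v|.
Proof.
move=> Sm Sn.
have [C C0 CP] := @bilinear_schwarz _ _ _ _ (star_component m n)
  (@star_continuous _ _ P _ _ Sm Sn).
exists C => [|u v k]; first exact: ltW.
have [->|kmn] := eqVneq k (m + n); first exact: CP.
by rewrite star_graded// normr0 !mulr_ge0// ltW.
Qed.

Lemma ex_star_bounded (F : seq R) : (forall m, m \in F -> rs_idx S m) ->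
  exists2 C, 0 <= C & star_bounded F C.
Proof.
move=> FS.
(* Guarding by membership in [F] makes the choice total: pairs outside [F] impose no condition. *)
have /choice[C CP] : forall p, exists c, p.1 \in F -> p.2 \in F -> 0 <= c /\
    forall (u : rs_comp S p.1) (v : rs_comp S p.2) k,
    `|P (ginj u) (ginj v) k| <= c * `|u| * `|v|.
  move=> -[m n].
  have [/andP[/= mF nF]|H] := boolP ((m \in F) && (n \in F)).
    by have [c c0 cP] := star_bounded_pair _ _ (FS _ mF) (FS _ nF); exists c.
  by exists 0 => /= mF nF; move: H; rewrite mF nF.
have FFP p : p \in [seq (m, n) | m <- F, n <- F] -> p.1 \in F /\ p.2 \in F.
  by move=> /allpairsP[q [? ? ->]].
(* The constants on [F] are nonnegative, so their sum dominates each of them. *)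
exists (\sum_(p <- [seq (m, n) | m <- F, n <- F]) C p).
  by rewrite big_seq sumr_ge0// => p /FFP[? ?]; case: (CP p).
move=> m n mF nF u v k.
have [_ /(_ u v k) /le_trans] := CP (m, n) mF nF; apply.
rewrite -!mulrA ler_wpM2r ?mulr_ge0//.
have mnF : (m, n) \in [seq (m, n) | m <- F, n <- F].
  by apply/allpairsP; exists (m, n).
rewrite (big_rem _ mnF)/= lerDl big_seq sumr_ge0// => p /mem_rem/FFP[? ?].
by case: (CP p).
Qed.

Lemma star_ginj_sum (F : seq R) (a b : tspace S) : uniq F ->
  (forall k, k \notin F -> a k = 0) -> (forall k, k \notin F -> b k = 0) ->
  P a b = \sum_(m <- F) \sum_(n <- F) P (ginj (a m)) (ginj (b n)).
Proof.
move=> uF aF bF; rewrite {1}(gsum_ginj _ _ uF aF) linear_sumlz.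
by apply: eq_bigr => m _; rewrite {1}(gsum_ginj _ _ uF bF) linear_sumr.
Qed.

(** By grading only the pairs with [m + n = k] contribute, so the bound [B] is asked for those
    alone; this constraint later makes the exponents match. The count of pairs is crude. *)
Lemma star_comp_bound (F : seq R) (C B : R) (a b : tspace S) k : uniq F ->
  (forall m, m \in F -> rs_idx S m) ->
  (forall k, k \notin F -> a k = 0) -> (forall k, k \notin F -> b k = 0) ->
  0 <= C -> star_bounded F C -> 0 <= B ->
  (forall m n : R, m \in F -> n \in F -> m + n = k :> R ->
    `|a m| * `|b n| <= B) ->
  `|P a b k| <= (size F)%:R ^+ 2 * (C * B).
Proof.
move=> uF FS aF bF C0 CP B0 abB.
rewrite (star_ginj_sum _ _ _ uF aF bF) gval_sum expr2 -mulrA.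
apply: ler_norm_sum_const => m mF; rewrite gval_sum.
apply: ler_norm_sum_const => n nF.
have [kE|kmn] := eqVneq k (m + n).
  apply: (le_trans (CP _ _ mF nF _ _ _)); rewrite -mulrA ler_wpM2l//.
  exact: abB.
by rewrite star_graded ?normr0 ?mulr_ge0//; exact: FS.
Qed.

End Star.

(** * Finiteness of levels, and triangularity of the structure group *)

Section GradedEstimates.
Context {R : realType} {S : regularity_structure R}.
Implicit Types (a : tspace S) (g : {linear tspace S -> tspace S}).

(** The index set is bounded below and locally finite, hence has finitely many elements up to
    [c]. *)
Lemma ex_index_seq (c : R) : exists F : seq R, [/\ uniq F,
  (forall m, m \in F -> rs_idx S m) &
  (forall m, rs_idx S m -> m < c -> m \in F)].
Proof.
have [l lS] := rs_idx_lbound S.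
have /finite_seqP[F FE] := @rs_idx_locally_finite _ S l c.
have FP m : m \in undup F <-> (rs_idx S `&` `[l, c]) m by rewrite mem_undup FE.
exists (undup F); split => [|m /FP[]//|m Sm mc]; first exact: undup_uniq.
by apply/FP; split => //=; rewrite in_itv/= (lS _ Sm) ltW.
Qed.

Lemma gval_trivial a k : ~ rs_idx S k -> a k = 0.
Proof. by move/rs_comp_trivial; exact. Qed.

Lemma tbelow_support (c c' : R) (F : seq R) a : c <= c' ->
  (forall m, rs_idx S m -> m < c' -> m \in F) ->
  tbelow c a -> forall k, k \notin F -> a k = 0.
Proof.
move=> cc' FS ac k kF; have [Sk|] := pselect (rs_idx S k); last first.
  exact: gval_trivial.
have [ck|kc] := leP c k; first exact: ac.
by move: kF; rewrite FS// (lt_le_trans kc).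
Qed.

Lemma grp_ginj_ge g (m : R) (u : rs_comp S m) k : rs_grp g -> m <= k ->
  g (ginj u) k = ginj u k.
Proof.
move=> gS mk; apply/eqP; rewrite -subr_eq0 -gvalB; apply/eqP.
exact: rs_grp_lower.
Qed.

Lemma grp_tbelow g a (c : R) : rs_grp g -> tbelow c a -> tbelow c (g a).
Proof.
move=> gS ac k ck; have /finite_seqP[F FE] := gval_fin a.
rewrite (gsum_ginj (undup F) a) ?undup_uniq//; last first.
  move=> m; rewrite mem_undup => mF; apply/eqP/negPn/negP => am.
  by apply: (negP mF); have : [set` F] m by rewrite -FE.
(* Levels from [c] upwards are empty, and the others gain only components of lower degree. *)
rewrite linear_sum gval_sum big1// => m _.
have [cm|mc] := leP c m; first by rewrite ac// ginj0 linear0.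
by rewrite grp_ginj_ge ?ginj_neq// ?lt_eqF// ?ltW// (lt_le_trans mc).
Qed.

Lemma sector_ge alpha (V : sector S alpha) a k :
  in_graded V a -> a k != 0 -> alpha <= k.
Proof.
move=> aV; rewrite leNgt; apply: contra_neqN => kalpha.
by have := aV k; rewrite sector_low.
Qed.

End GradedEstimates.

(** * Suprema in the extended nonnegative reals *)

Section NonnegSup.
Context {R : realType}.
Implicit Type E : set R.

Lemma nonneg_sup_ge0 E : (0 <= nonneg_sup E)%E.
Proof. by apply: ereal_sup_ubound; left. Qed.

Lemma nonneg_sup_ubound E r : E r -> (r%:E <= nonneg_sup E)%E.
Proof. by move=> Er; apply: ereal_sup_ubound; right; exists r. Qed.

Lemma nonneg_sup_le E (B : R) : 0 <= B -> (forall r, E r -> r <= B) ->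
  (nonneg_sup E <= B%:E)%E.
Proof.
move=> B0 EB; apply: ge_ereal_sup => _ [->|[r Er <-]]; rewrite lee_fin//.
exact: EB.
Qed.

End NonnegSup.

(** * Norms of modelled distributions and of the model *)

Section Model.
Context {R : realType} {S : regularity_structure R} {d : nat} {s : scaling d}.
Variable M : model S s.
Local Notation Gamma := (model_Gamma M).
Implicit Types (K : set 'rV[R]_d) (f : 'rV[R]_d -> tspace S).

Lemma snorm_ge0 (x : 'rV[R]_d) : 0 <= snorm s x.
Proof. by apply: sumr_ge0 => i _; exact: powR_ge0. Qed.

Lemma moddist_norm_ge0 (gamma : R) K f : (0 <= moddist_norm M gamma K f)%E.
Proof. by rewrite adde_ge0 ?nonneg_sup_ge0. Qed.

Lemma moddist_norm_le (gamma : R) K f (B1 B2 : R) : 0 <= B1 -> 0 <= B2 ->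
  (forall x beta, K x -> rs_idx S beta -> beta < gamma ->
    `|f x beta| <= B1) ->
  (forall x y beta, K x -> K y -> 0 < snorm s (x - y) <= 1 ->
    rs_idx S beta -> beta < gamma ->
    `|(f x - Gamma x y (f y)) beta| <=
      B2 * snorm s (x - y) `^ (gamma - beta)) ->
  (moddist_norm M gamma K f <= (B1 + B2)%:E)%E.
Proof.
move=> B10 B20 fB1 fB2; rewrite EFinD; apply: leeD; apply: nonneg_sup_le => //.
  by move=> _ [x [beta [Kx Sbeta bg ->]]]; exact: fB1.
move=> _ [x [y [beta [[Kx Ky] xy Sbeta bg ->]]]].
have [xy0|] := ltP 0 (snorm s (x - y)).
  rewrite ler_pdivrMr ?powR_gt0//.
  by apply: fB2 => //; rewrite xy0.
(* At distance zero the quotient is 0 by the default value of the inverse, as the exponent is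
   nonzero. *)
rewrite le_eqVlt ltNge snorm_ge0 orbF => /eqP ->.
by rewrite powR0 ?invr0 ?mulr0// subr_eq0 gt_eqF.
Qed.

(** Components outside the index set or of degree at least [gamma] vanish, so [beta] is left
    free. *)
Lemma moddist_norm_size (gamma : R) K f (B : R) :
  (forall x, tbelow gamma (f x)) ->
  (moddist_norm M gamma K f <= B%:E)%E ->
  forall x beta, K x -> `|f x beta| <= B.
Proof.
move=> fg fB x beta Kx; have B0 : 0 <= B.
  by rewrite -lee_fin (le_trans (moddist_norm_ge0 _ _ _) fB).
have [Sbeta|] := pselect (rs_idx S beta); last first.
  by move=> NS; rewrite gval_trivial// normr0.
have [gb|bg] := leP gamma beta; first by rewrite fg// normr0.
rewrite -lee_fin (le_trans _ fB)// /moddist_norm.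
rewrite (@le_trans _ _ (moddist_size gamma K f))//.
  by apply: nonneg_sup_ubound; exists x, beta.
by rewrite leeDl// nonneg_sup_ge0.
Qed.

Lemma moddist_norm_osc (gamma : R) K f (B : R) :
  (moddist_norm M gamma K f <= B%:E)%E ->
  forall x y beta, K x -> K y -> 0 < snorm s (x - y) <= 1 -> beta < gamma ->
  `|(f x - Gamma x y (f y)) beta| <= B * snorm s (x - y) `^ (gamma - beta).
Proof.
move=> fB x y beta Kx Ky /andP[xy0 xy1] bg; have B0 : 0 <= B.
  by rewrite -lee_fin (le_trans (moddist_norm_ge0 _ _ _) fB).
have [Sbeta|] := pselect (rs_idx S beta); last first.
  by move=> NS; rewrite gval_trivial// normr0 mulr_ge0// powR_ge0.
rewrite -ler_pdivrMr ?powR_gt0// -lee_fin (le_trans _ fB)// /moddist_norm.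
rewrite (@le_trans _ _ (moddist_osc M gamma K f))//.
  by apply: nonneg_sup_ubound; exists x, y, beta.
by rewrite leeDr// nonneg_sup_ge0.
Qed.

(* The summand [1] accounts for [k = m], where [Gamma_bound] says nothing and
   [Gamma] acts as the identity. *)
Lemma Gamma_bound_component (gamma : R) K (C : R) x y m k (u : rs_comp S m) :
  Gamma_bound s Gamma gamma K C -> 0 <= C -> K x -> K y ->
  rs_idx S m -> m < gamma ->
  `|Gamma x y (ginj u) k| <= (1 + C) * `|u| * snorm s (x - y) `^ (m - k).
Proof.
move=> GC C0 Kx Ky Sm mg.
have rhs0 : 0 <= (1 + C) * `|u| * snorm s (x - y) `^ (m - k).
  by rewrite !mulr_ge0 ?powR_ge0// addr_ge0.
have [Sk|NS] := pselect (rs_idx S k); last first.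
  by rewrite gval_trivial// normr0.
have GS := model_Gamma_grp M x y.
have [km|mk|km] := ltgtP k m.
- apply: (le_trans (GC _ _ Kx Ky _ Sm mg _ Sk km u)).
  by rewrite !ler_wpM2r ?powR_ge0// lerDr.
- by rewrite grp_ginj_ge ?(ltW mk)// ginj_neq ?lt_eqF// normr0.
- subst k; rewrite grp_ginj_ge// ginj_id subrr powRr0 mulr1.
  by rewrite ler_peMl// lerDl.
Qed.

Lemma Gamma_bound_widen (gamma gamma' : R) K (C C' : R) :
  gamma' <= gamma -> C <= C' ->
  Gamma_bound s Gamma gamma K C -> Gamma_bound s Gamma gamma' K C'.
Proof.
move=> gg CC GC x y Kx Ky l Sl lg m Sm ml u.
apply: (le_trans (GC x y Kx Ky l Sl (lt_le_trans lg gg) m Sm ml u)).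
by rewrite !ler_wpM2r// powR_ge0.
Qed.

Lemma ex_Gamma_bound (gamma : R) K : compact K ->
  exists2 C, 0 <= C & Gamma_bound s Gamma gamma K C.
Proof.
(* A model gives bounds at positive levels only; the bound at a higher level restricts to
   [gamma]. *)
move=> cK; have g0 : 0 < Num.max gamma 1 by rewrite lt_max ltr01 orbT.
have [C [_ GC]] := @model_bounds _ _ _ _ M _ g0 K cK.
exists (Num.max C 0); first by rewrite le_max lexx orbT.
by apply: Gamma_bound_widen GC; rewrite le_max lexx.
Qed.

Lemma Gamma_norm_ge0 (gamma : R) K : compact K -> 0 <= Gamma_norm M gamma K.
Proof.
move=> cK; apply: lb_le_inf => [|C []//].
by have [C C0 GC] := ex_Gamma_bound gamma _ cK; exists C.
Qed.

(** The infimum is attained: where [|u| * t] is positive, every admissible constant dominates the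
    same quotient; where it is zero, any admissible constant forces the left side to vanish.
    Compactness makes the set of constants nonempty. *)
Lemma Gamma_normP (gamma : R) K : compact K ->
  Gamma_bound s Gamma gamma K (Gamma_norm M gamma K).
Proof.
move=> cK x y Kx Ky l Sl lg m Sm ml u.
have n0 : nonempty [set C | 0 <= C /\ Gamma_bound s Gamma gamma K C].
  by have [C C0 GC] := ex_Gamma_bound gamma _ cK; exists C.
set t := snorm s _ `^ _.
have : 0 <= `|u| * t by rewrite mulr_ge0// powR_ge0.
rewrite -mulrA le_eqVlt => /orP[/eqP ut0|ut0]; last first.
  rewrite -ler_pdivrMr//; apply: lb_le_inf => // C [_ GC].
  by rewrite ler_pdivrMr// mulrA; exact: GC.
have [C [_ GC]] := n0.
apply: (le_trans (GC _ _ Kx Ky _ Sl lg _ Sm ml u)).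
by rewrite -mulrA -/t -ut0 !mulr0.
Qed.

End Model.

(** * The truncated product as a finite double sum *)

Section Multiplication.
Context {R : realType} {S : regularity_structure R} (P : product S).
Variables (gamma1 gamma2 : R) (F : seq R) (C : R).
Hypothesis uF : uniq F.
Hypothesis FS : forall m, m \in F -> rs_idx S m.
Hypothesis SF : forall m, rs_idx S m -> m < Num.max gamma1 gamma2 -> m \in F.
Hypothesis C0 : 0 <= C.
Hypothesis PC : star_bounded P F C.

Let supp1 (a : tspace S) : tbelow gamma1 a -> forall k, k \notin F -> a k = 0.
Proof. by apply: tbelow_support SF; rewrite le_max lexx. Qed.

Let supp2 (a : tspace S) : tbelow gamma2 a -> forall k, k \notin F -> a k = 0.
Proof. by apply: tbelow_support SF; rewrite le_max lexx orbT. Qed.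

(** If [m] or [n] lies outside [F], one of the two factors vanishes. *)
Lemma moddist_mulE d (gamma : R) (f1 f2 : 'rV[R]_d -> tspace S) x :
  tbelow gamma1 (f1 x) -> tbelow gamma2 (f2 x) ->
  moddist_mul P gamma f1 f2 x =
  \sum_(m <- F) \sum_(n <- F | m + n < gamma)
    P (ginj (f1 x m)) (ginj (f2 x n)).
Proof.
move=> f1x f2x; rewrite /moddist_mul.
set FF := [seq p <- [seq (m, n) | m <- F, n <- F] | p.1 + p.2 < gamma].
have FFP p : (p \in FF) = [&& p.1 + p.2 < gamma, p.1 \in F & p.2 \in F].
  rewrite mem_filter; congr (_ && _); apply/allpairsP/andP.
    by move=> [q [? ? ->]].
  by case: p => m n [? ?]; exists (m, n).
rewrite (fsbigE FF) => [|||[m n] [/= Sm Sn mn]].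
- rewrite big_seq_cond big_mkcondr.
  rewrite (eq_bigr (fun p => P (ginj (f1 x p.1)) (ginj (f2 x p.2)))).
    rewrite -big_seq big_filter big_mkcond big_allpairs.
    by apply: eq_bigr => m _; rewrite [RHS]big_mkcond.
  move=> p; rewrite FFP => /and3P[mn /FS Sm /FS Sn].
  by rewrite ifT// inE.
- by rewrite filter_uniq// allpairs_uniq// => -[? ?] [? ?].
- by move=> p /=; rewrite FFP => /and3P[mn /FS Sm /FS Sn].
- rewrite FFP/= mn/= negb_and /tproj.
  move=> /orP[/(supp1 _ f1x)|/(supp2 _ f2x)] /= ->.
    by rewrite ginj0 linear0l.
  by rewrite ginj0 linear0r.
Qed.

Lemma moddist_mul_tbelow d (gamma : R) (f1 f2 : 'rV[R]_d -> tspace S) x :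
  tbelow gamma1 (f1 x) -> tbelow gamma2 (f2 x) ->
  tbelow gamma (moddist_mul P gamma f1 f2 x).
Proof.
move=> f1x f2x k gk; rewrite moddist_mulE// gval_sum big_seq big1// => m mF.
rewrite gval_sum big_seq_cond big1// => n /andP[nF mn].
by rewrite star_graded ?gt_eqF ?(lt_le_trans mn)//; exact: FS.
Qed.

(** The discarded pairs live in degrees [m + n >= gamma], so below [gamma] the truncation is
    invisible. *)
Lemma moddist_mul_comp d (gamma : R) (f1 f2 : 'rV[R]_d -> tspace S) x k :
  tbelow gamma1 (f1 x) -> tbelow gamma2 (f2 x) -> k < gamma ->
  moddist_mul P gamma f1 f2 x k = P (f1 x) (f2 x) k.
Proof.
move=> f1x f2x kg; rewrite moddist_mulE//.
rewrite (star_ginj_sum P F _ _ uF (supp1 _ f1x) (supp2 _ f2x)).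
rewrite !gval_sum; apply: eq_big_seq => m mF; rewrite !gval_sum big_mkcond.
apply: eq_big_seq => n nF; case: ltP => // mn.
by rewrite star_graded ?lt_eqF ?(lt_le_trans kg)//; exact: FS.
Qed.

(** * Size and increments of the product *)

Section Bounds.
Context {d : nat} {s : scaling d} (M : model S s).
Local Notation Gamma := (model_Gamma M).
Variables (alpha1 alpha2 : R) (V : sector S alpha1) (W : sector S alpha2).
Variables (f1 f2 : 'rV[R]_d -> tspace S) (gamma : R).
Hypothesis gammaE : gamma = Num.min (gamma1 + alpha2) (gamma2 + alpha1).
Hypothesis f1_below : forall x, tbelow gamma1 (f1 x).
Hypothesis f2_below : forall x, tbelow gamma2 (f2 x).
Hypothesis f1V : forall x, in_graded V (f1 x).
Hypothesis f2W : forall x, in_graded W (f2 x).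
Hypothesis VW : regular_pair P gamma V W.

Let gamma_le1 : gamma <= gamma1 + alpha2.
Proof. by rewrite gammaE ge_min lexx. Qed.

Let gamma_le2 : gamma <= gamma2 + alpha1.
Proof. by rewrite gammaE ge_min lexx orbT. Qed.

Local Notation D1 x y := (f1 x - Gamma x y (f1 y)).
Local Notation D2 x y := (f2 x - Gamma x y (f2 y)).

Let Gf1_below x y : tbelow gamma1 (Gamma x y (f1 y)).
Proof. exact/grp_tbelow/f1_below/model_Gamma_grp. Qed.

Let Gf2_below x y : tbelow gamma2 (Gamma x y (f2 y)).
Proof. exact/grp_tbelow/f2_below/model_Gamma_grp. Qed.

(** Regularity of the pair moves [Gamma] inside the product exactly on the levels that the
    truncation keeps; the other levels of the full product are subtracted. *)
Lemma Gamma_moddist_mul x y :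
  Gamma x y (moddist_mul P gamma f1 f2 y) =
  P (Gamma x y (f1 y)) (Gamma x y (f2 y)) -
  \sum_(m <- F) \sum_(n <- F | ~~ (m + n < gamma))
    P (Gamma x y (ginj (f1 y m))) (Gamma x y (ginj (f2 y n))).
Proof.
apply/eqP; rewrite eq_sym subr_eq; apply/eqP.
have E1 : Gamma x y (f1 y) = \sum_(m <- F) Gamma x y (ginj (f1 y m)).
  by rewrite {1}(gsum_ginj F _ uF (supp1 _ (f1_below y))) linear_sum.
have E2 : Gamma x y (f2 y) = \sum_(n <- F) Gamma x y (ginj (f2 y n)).
  by rewrite {1}(gsum_ginj F _ uF (supp2 _ (f2_below y))) linear_sum.
rewrite E1 E2 linear_sumlz moddist_mulE// linear_sum -big_split.
apply: eq_bigr => m _; rewrite linear_sumr (bigID (fun n => m + n < gamma)).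
congr (_ + _); rewrite linear_sum; apply: eq_bigr => n mn.
by rewrite VW//; [exact: model_Gamma_grp|exact: f1V|exact: f2W].
Qed.

(** Inserts the mixed product of [f1 x] and [Gamma x y (f2 y)]. *)
Lemma moddist_mul_decomp x y k : k < gamma ->
  (moddist_mul P gamma f1 f2 x - Gamma x y (moddist_mul P gamma f1 f2 y)) k =
  P (f1 x) (D2 x y) k + P (D1 x y) (Gamma x y (f2 y)) k +
  \sum_(m <- F) \sum_(n <- F | ~~ (m + n < gamma))
    P (Gamma x y (ginj (f1 y m))) (Gamma x y (ginj (f2 y n))) k.
Proof.
move=> kg; rewrite gvalB moddist_mul_comp// Gamma_moddist_mul gvalB.
rewrite linearBr linearBl !gvalB [in RHS]subrKA opprB addrA addrAC.
rewrite gval_sum; congr (_ + _); apply: eq_bigr => m _.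
by rewrite gval_sum.
Qed.

Variables (K : set 'rV[R]_d) (gammaG G a1 a2 : R).
Hypothesis G0 : 0 <= G.
Hypothesis GammaG : Gamma_bound s Gamma gammaG K G.
Hypothesis le_gammaG : Num.max gamma1 gamma2 <= gammaG.
Hypothesis f1a : (moddist_norm M gamma1 K f1 <= a1%:E)%E.
Hypothesis f2a : (moddist_norm M gamma2 K f2 <= a2%:E)%E.

Local Notation N := ((size F)%:R : R).

Let a1_ge0 : 0 <= a1.
Proof. by rewrite -lee_fin (le_trans (moddist_norm_ge0 _ _ _ _) f1a). Qed.

Let a2_ge0 : 0 <= a2.
Proof. by rewrite -lee_fin (le_trans (moddist_norm_ge0 _ _ _ _) f2a). Qed.

Let D1_below x y : tbelow gamma1 (D1 x y).
Proof. by move=> k gk; rewrite gvalB f1_below// Gf1_below// subrr. Qed.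

Let D2_below x y : tbelow gamma2 (D2 x y).
Proof. by move=> k gk; rewrite gvalB f2_below// Gf2_below// subrr. Qed.

Lemma moddist_mul_size x k : K x -> k < gamma ->
  `|moddist_mul P gamma f1 f2 x k| <= N ^+ 2 * (C * (a1 * a2)).
Proof.
move=> Kx kg; rewrite moddist_mul_comp//.
apply: star_comp_bound => //.
- exact: supp1.
- exact: supp2.
- exact: mulr_ge0.
- move=> m n _ _ _; apply: ler_pM => //.
    exact: (moddist_norm_size _ _ _ _ _ f1_below f1a).
  exact: (moddist_norm_size _ _ _ _ _ f2_below f2a).
Qed.

Section Increment.
Variables (x y : 'rV[R]_d) (k : R).
Hypotheses (Kx : K x) (Ky : K y) (kg : k < gamma).
Local Notation t := (snorm s (x - y)).
Hypothesis xy : 0 < t <= 1.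

Lemma star_left_increment :
  `|P (f1 x) (D2 x y) k| <= N ^+ 2 * (C * (a1 * a2 * t `^ (gamma - k))).
Proof.
apply: star_comp_bound => //.
- exact: supp1.
- exact: supp2.
- by rewrite !mulr_ge0// powR_ge0.
- move=> m n _ _ mn; have [->|f1m] := eqVneq (f1 x m) 0.
    by rewrite normr0 mul0r !mulr_ge0// powR_ge0.
  have am := sector_ge _ _ _ _ (f1V x) f1m.
  (* From [m + n = k] and [alpha1 <= m] follow [n < gamma2] and [gamma2 - n >= gamma - k]; as
     [t <= 1], the larger exponent gives the smaller power. *)
  have [k_lt gle] := (kg, gamma_le2);
  have ng : n < gamma2 by lra.
  rewrite -mulrA; apply: ler_pM => //.
    exact: (moddist_norm_size _ _ _ _ _ f1_below f1a).
  apply: (le_trans (moddist_norm_osc _ _ _ _ _ f2a _ _ _ Kx Ky xy ng)).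
  by rewrite ler_wpM2l// ger_powR//; lra.
Qed.

Lemma star_right_increment :
  `|P (D1 x y) (Gamma x y (f2 y)) k| <=
  N ^+ 2 * (C * (2 * (a1 * a2 * t `^ (gamma - k)))).
Proof.
apply: star_comp_bound => //.
- exact: supp1.
- exact: supp2.
- by rewrite !mulr_ge0// powR_ge0.
- move=> m n _ _ mn; have [->|f2n] := eqVneq (Gamma x y (f2 y) n) 0.
    by rewrite normr0 mulr0 !mulr_ge0// powR_ge0.
  (* Sectors are stable under the group, so [Gamma x y (f2 y)] stays in [W]. *)
  have an : alpha2 <= n.
    by apply: sector_ge f2n; apply: sector_grp => //; exact: model_Gamma_grp.
  have [k_lt gle] := (kg, gamma_le1);
  have mg : m < gamma1 by lra.
  have ng : n < gamma2.
    by rewrite ltNge; apply: contra_neqN f2n => gn; exact: Gf2_below.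
  have -> : 2 * (a1 * a2 * t `^ (gamma - k)) =
      a1 * t `^ (gamma - k) * (a2 * 2) by lra.
  apply: ler_pM => //.
    apply: (le_trans (moddist_norm_osc _ _ _ _ _ f1a _ _ _ Kx Ky xy mg)).
    by rewrite ler_wpM2l// ger_powR//; lra.
  (* The source of the factor 2: both terms are at most [a2], so no bound on [Gamma] enters here. *)
  have -> : Gamma x y (f2 y) n = f2 x n - D2 x y n by rewrite gvalB subKr.
  rewrite (le_trans (ler_normB _ _))// mulr_natr mulr2n lerD//.
    exact: (moddist_norm_size _ _ _ _ _ f2_below f2a).
  apply: (le_trans (moddist_norm_osc _ _ _ _ _ f2a _ _ _ Kx Ky xy ng)).
  rewrite ler_piMr// -(powRr0 t) ger_powR//; lra.
Qed.

(* [Gamma] is not multiplicative on these levels, and [Gamma] is bounded on each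
   factor separately: hence the square of [1 + G]. *)
Lemma star_overflow m n : m \in F -> n \in F -> gamma <= m + n ->
  `|P (Gamma x y (ginj (f1 y m))) (Gamma x y (ginj (f2 y n))) k| <=
  N ^+ 2 * (C * ((1 + G) ^+ 2 * (a1 * a2 * t `^ (gamma - k)))).
Proof.
move=> mF nF mn.
have B0 : 0 <= (1 + G) ^+ 2 * (a1 * a2 * t `^ (gamma - k)).
  by rewrite mulr_ge0 ?sqr_ge0// !mulr_ge0// powR_ge0.
have rhs0 : 0 <= N ^+ 2 * (C * ((1 + G) ^+ 2 * (a1 * a2 * t `^ (gamma - k)))).
  by rewrite mulr_ge0 ?sqr_ge0// mulr_ge0.
have [gm|mg] := leP gamma1 m.
  by rewrite f1_below// ginj0 linear0 linear0l normr0.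
have [gn|ng] := leP gamma2 n.
  by rewrite f2_below// ginj0 linear0 linear0r normr0.
have ginj_below c l (u : rs_comp S l) : l < c -> tbelow c (ginj u).
  by move=> lc j cj; rewrite ginj_neq// lt_eqF// (lt_le_trans lc).
apply: star_comp_bound => //.
- apply/supp1/grp_tbelow; [exact: model_Gamma_grp|exact: ginj_below].
- apply/supp2/grp_tbelow; [exact: model_Gamma_grp|exact: ginj_below].
move=> i j _ _ ij.
have [mG nG] : m < gammaG /\ n < gammaG.
  by split; apply: lt_le_trans le_gammaG; rewrite lt_max ?mg ?ng ?orbT.
have H1 := Gamma_bound_component _ _ _ _ _ _ _ i (f1 y m)
  GammaG G0 Kx Ky (FS _ mF) mG.
have H2 := Gamma_bound_component _ _ _ _ _ _ _ j (f2 y n)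
  GammaG G0 Kx Ky (FS _ nF) nG.
apply: (le_trans (ler_pM _ _ H1 H2)) => //.
have -> : (1 + G) * `|f1 y m| * t `^ (m - i) *
    ((1 + G) * `|f2 y n| * t `^ (n - j)) =
    (1 + G) ^+ 2 * (`|f1 y m| * `|f2 y n| * (t `^ (m - i) * t `^ (n - j))).
  by ring.
have /andP[t0 _] := xy.
(* Since [i + j = k], the exponents add up to [m + n - k >= gamma - k]. *)
rewrite -powRD; last by rewrite (gt_eqF t0) implybT.
rewrite ler_wpM2l ?sqr_ge0// ler_pM ?mulr_ge0 ?powR_ge0//.
  apply: ler_pM => //.
    exact: (moddist_norm_size _ _ _ _ _ f1_below f1a).
  exact: (moddist_norm_size _ _ _ _ _ f2_below f2a).
by have k_lt := kg; rewrite ger_powR//; lra.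
Qed.

(** The 3 is one from the left increment plus two from the right one. [N ^+ 4] counts at most
    [N ^+ 2] overflow pairs, each with a bound carrying [N ^+ 2]. *)
Lemma moddist_mul_increment :
  `|(moddist_mul P gamma f1 f2 x -
     Gamma x y (moddist_mul P gamma f1 f2 y)) k| <=
  C * (3 * N ^+ 2 + N ^+ 4) * (a1 * a2 * (1 + G) ^+ 2) * t `^ (gamma - k).
Proof.
rewrite moddist_mul_decomp//.
have H3 : `|\sum_(m <- F) \sum_(n <- F | ~~ (m + n < gamma))
    P (Gamma x y (ginj (f1 y m))) (Gamma x y (ginj (f2 y n))) k| <=
    N * (N * (N ^+ 2 * (C * ((1 + G) ^+ 2 * (a1 * a2 * t `^ (gamma - k)))))).
  apply: ler_norm_sum_const => m mF; rewrite big_mkcond.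
  apply: ler_norm_sum_const => n nF; case: ltP => mn /=.
    rewrite normr0 mulr_ge0 ?sqr_ge0// mulr_ge0//
      mulr_ge0 ?sqr_ge0// !mulr_ge0//.
    exact: powR_ge0.
  exact: star_overflow.
have ND : forall u v w : rs_comp S k, `|u + v + w| <= `|u| + `|v| + `|w|.
  by move=> u v w; rewrite (le_trans (ler_normD _ _))// lerD2r ler_normD.
apply: (le_trans (ND _ _ _)).
have /le_trans := lerD (lerD star_left_increment star_right_increment) H3.
apply; move: (t `^ _) (powR_ge0 t (gamma - k)) => T T0.
have aT : 0 <= C * N ^+ 2 * (a1 * a2 * T).
  by rewrite !mulr_ge0// sqr_ge0.
(* Only the overflow term carries this square; the other two are enlarged to match it. *)
have G1 : 1 <= (1 + G) ^+ 2 by rewrite expr_ge1// ?lerDl// addr_ge0.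
have -> : C * (3 * N ^+ 2 + N ^+ 4) * (a1 * a2 * (1 + G) ^+ 2) * T =
  3 * (C * N ^+ 2 * (a1 * a2 * T) * (1 + G) ^+ 2) +
  N * (N * (N ^+ 2 * (C * ((1 + G) ^+ 2 * (a1 * a2 * T))))) by ring.
rewrite lerD2r; have := ler_peMr aT G1; lra.
Qed.

End Increment.

(** The size bound adds one more [N ^+ 2]. Leaving [gammaG] and [G] free allows two uses: finiteness
    with any model constant, and the quantitative bound with [Gamma_norm]. *)
Lemma moddist_norm_mul :
  (moddist_norm M gamma K (moddist_mul P gamma f1 f2) <=
   (C * (4 * N ^+ 2 + N ^+ 4) * (a1 * a2 * (1 + G) ^+ 2))%:E)%E.
Proof.
have G1 : 1 <= (1 + G) ^+ 2 by rewrite expr_ge1// ?lerDl// addr_ge0.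
have A0 : 0 <= C * (a1 * a2) by rewrite !mulr_ge0.
have A1 : 0 <= N ^+ 2 * (C * (a1 * a2)) by rewrite mulr_ge0 ?sqr_ge0.
have A2 : 0 <= C * (3 * N ^+ 2 + N ^+ 4) * (a1 * a2 * (1 + G) ^+ 2).
  by rewrite mulr_ge0 ?mulr_ge0 ?addr_ge0 ?mulr_ge0 ?exprn_ge0 ?addr_ge0.
have norm_le := moddist_norm_le M _ _ _ _ _ A1 A2.
apply: (le_trans (norm_le _ _ _ _ _)) => [x k Kx _ kg|x y k Kx Ky xy _ kg|].
- exact: moddist_mul_size.
- exact: moddist_mul_increment.
rewrite lee_fin; have := ler_peMr A1 G1; lra.
Qed.

End Bounds.
End Multiplication.

(** * Membership of the product and the uniform bound *)

Theorem theorem4p7 (R : realType) (S : regularity_structure R) (P : product S)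
  (gamma1 gamma2 : R) :
  exists C : R, 0 < C /\
    forall (d : nat) (s : scaling d) (M : model S s) (alpha1 alpha2 : R)
      (V : sector S alpha1) (W : sector S alpha2)
      (f1 f2 : 'rV[R]_d -> tspace S) (gamma : R),
      moddist_in M gamma1 V f1 ->
      moddist_in M gamma2 W f2 ->
      gamma = Num.min (gamma1 + alpha2) (gamma2 + alpha1) ->
      regular_pair P gamma V W ->
      moddist M gamma (moddist_mul P gamma f1 f2) /\
      (0 <= gamma1 -> 0 <= gamma2 ->
       forall K : set 'rV[R]_d, compact K ->
       (moddist_norm M gamma K (moddist_mul P gamma f1 f2) <=
          C%:E * moddist_norm M gamma1 K f1 * moddist_norm M gamma2 K f2 *
          ((1 + Gamma_norm M (gamma1 + gamma2) K) ^+ 2)%:E)%E).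
Proof.
(* The levels and the product constant are fixed before any scaling, model or distribution
   appears. *)
have [F [uF FS SF]] := ex_index_seq (S := S) (Num.max gamma1 gamma2).
have [C C0 PC] := ex_star_bounded P F FS.
pose C' := C * (4 * (size F)%:R ^+ 2 + (size F)%:R ^+ 4).
have C'0 : 0 <= C' by rewrite mulr_ge0// addr_ge0// ?mulr_ge0// exprn_ge0.
(* [C'] vanishes when [F] is empty; adding 1 makes the constant strictly positive. *)
exists (C' + 1); split=> [|d s M alpha1 alpha2 V W f1 f2 gamma].
  by rewrite ltr_wpDl.
move=> [[f1g f1fin] f1V] [[f2g f2fin] f2W] gammaE VW.
have finE (c : R) f K : (moddist_norm M c K f < +oo)%E ->
    exists a : R, moddist_norm M c K f = a%:E.
  move=> fin; exists (fine (moddist_norm M c K f)).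
  by rewrite fineK// ge0_fin_numE// moddist_norm_ge0.
have normE K : compact K ->
    exists a1 a2 : R, [/\ moddist_norm M gamma1 K f1 = a1%:E,
      moddist_norm M gamma2 K f2 = a2%:E & forall gammaG G, 0 <= G ->
      Gamma_bound s (model_Gamma M) gammaG K G ->
      Num.max gamma1 gamma2 <= gammaG ->
      (moddist_norm M gamma K (moddist_mul P gamma f1 f2) <=
       (C' * (a1 * a2 * (1 + G) ^+ 2))%:E)%E].
  move=> cK; have [a1 a1E] := finE _ _ _ (f1fin _ cK).
  have [a2 a2E] := finE _ _ _ (f2fin _ cK).
  exists a1, a2; split=> // gammaG G G0 GG le_gammaG.
  by apply: (moddist_norm_mul P gamma1 gamma2 F C uF FS SF C0 PC M alpha1
    alpha2 V W f1 f2 gamma gammaE f1g f2g f1V f2W VW K gammaG);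
    rewrite ?a1E ?a2E.
split.
  split=> [x|K cK]; first exact: (moddist_mul_tbelow P gamma1 gamma2 F).
  have [a1 [a2 [_ _ bound]]] := normE _ cK.
  (* For finiteness any constant at this level will do, whatever the signs of [gamma1] and
     [gamma2]. *)
  have [G G0 GG] := ex_Gamma_bound M (Num.max gamma1 gamma2) K cK.
  by apply: le_lt_trans (bound _ _ G0 GG _) _; rewrite ?ltry.
move=> g10 g20 K cK; have [a1 [a2 [a1E a2E bound]]] := normE _ cK.
have G0 := Gamma_norm_ge0 M (gamma1 + gamma2) K cK.
apply: (le_trans (bound _ _ G0 (Gamma_normP M _ K cK) _)).
  (* Nonnegativity of both exponents lets the level [gamma1 + gamma2] cover every level below
     [max gamma1 gamma2]. *)
  by rewrite ge_max lerDl lerDr g10 g20.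
have a10 : 0 <= a1 by rewrite -lee_fin -a1E moddist_norm_ge0.
have a20 : 0 <= a2 by rewrite -lee_fin -a2E moddist_norm_ge0.
rewrite a1E a2E -!EFinM lee_fin.
have rhs0 : 0 <= a1 * a2 * (1 + Gamma_norm M (gamma1 + gamma2) K) ^+ 2.
  by rewrite !mulr_ge0 ?exprn_ge0 ?addr_ge0.
lra.
Qed.
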